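(* Let $x^\star\in\mathbb{R}^n$ be a feasible point of (MPBVC) at which BVC-GCQ and partial BVC-LICQ with $\mathcal{B}^H_{\mathrm{nsg}}$ hold. Then GCQ holds at $x^\star$, i.e. $\mathcal{L}(x^\star)^-=\mathcal{T}(X,x^\star)^-$.
   Context: Setting. Let $f,H_i,G_{i,j}:\mathbb{R}^n\to\mathbb{R}$ ($1\le i\le n_H$, $1\le j\le n_G$, with $n_H,n_G\ge1$), $g:\mathbb{R}^n\to\mathbb{R}^{n_g}$, $h:\mathbb{R}^n\to\mathbb{R}^{n_h}$ be twice continuously differentiable. (MPBVC) is the problem: minimize $f(x)$ subject to $g(x)=0$, $h(x)\ge0$, $H_i(x)\ge0$ for all $i$, and $G_{i,j}(x)H_i(x)\ge0$ for all $(i,j)$. Its feasible set is $X$. Index sets at a feasible point $x^\star$: let $\mathcal{I}_{(+,0)}$ be the set of $(i,j)$ with $H_i(x^\star)>0$, $G_{i,j}(x^\star)=0$; let $\mathcal{I}_{(0,+)},\mathcal{I}_{(0,0)},\mathcal{I}_{(0,-)}$ be the sets of $(i,j)$ with $H_i(x^\star)=0$ and $G_{i,j}(x^\star)>0$, $=0$, $<0$ respectively. For each of these, $\mathcal{I}^H_{(\cdot,\cdot)}=\{i\mid \exists j:(i,j)\in\mathcal{I}_{(\cdot,\cdot)}\}$. Let $\mathcal{I}_h=\{l\mid h_l(x^\star)=0\}$. Cones. The tangent cone is $\mathcal{T}(X,x^\star)=\{d\in\mathbb{R}^n\mid \exists\, x^{(k)}\in X,\ t^{(k)}>0,\ t^{(k)}\to0,\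 x^{(k)}\to x^\star,\ (x^{(k)}-x^\star)/t^{(k)}\to d\}$. The polar cone of $M\subseteq\mathbb{R}^n$ is $M^-=\{d\mid\langle d,x\rangle\le0\ \forall x\in M\}$. The linearized cone $\mathcal{L}(x^\star)$ of (MPBVC) is, explicitly, the set of $d\in\mathbb{R}^n$ with $\nabla g_k(x^\star)^Td=0$ for all $k$; $\nabla h_l(x^\star)^Td\ge0$ for $l\in\mathcal{I}_h$; $\nabla H_i(x^\star)^Td=0$ for $i\in\mathcal{I}^H_{(0,-)}$; $\nabla H_i(x^\star)^Td\ge0$ for $i\in\mathcal{I}^H_{(0,0)}\cup\mathcal{I}^H_{(0,+)}$; $\nabla G_{i,j}(x^\star)^Td\ge0$ for $(i,j)\in\mathcal{I}_{(+,0)}$. $\mathcal{L}^{\mathrm{super}}(x^\star)$ is the set of $d$ with $\nabla g_k(x^\star)^Td=0$ for all $k$; $\nabla h_l(x^\star)^Td\ge0$ for $l\in\mathcal{I}_h$; $\nabla H_i(x^\star)^Td=0$ for $i\in\mathcal{I}^H_{(0,-)}$; $\nabla H_i(x^\star)^Td\ge0$ for $i\in\mathcal{I}^H_{(0,+)}$; $\nabla G_{i,j}(x^\star)^Td\ge0$ for $(i,j)\in\mathcal{I}_{(+,0)}$. The BVC-linearized cone $\mathcal{L}^{\mathrm{BVC}}(x^\star)$ is the set of $d\in\mathcal{L}^{\mathrm{super}}(x^\star)$ with $\nabla H_i(x^\star)^Td\ge0$ for $i\in\mathcal{I}^H_{(0,0)}$ and $(\nabla H_i(x^\star)^Td)(\nabla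 G_{i,j}(x^\star)^Td)\ge0$ for $(i,j)\in\mathcal{I}_{(0,0)}$. BVC-GCQ holds at $x^\star$ if $\mathcal{L}^{\mathrm{BVC}}(x^\star)^-=\mathcal{T}(X,x^\star)^-$. Nonsingular indices: an inequality $a_id\ge r_i$ of a linear system $Ad\ge r$, $Bd=q$ is nonsingular if some solution $d$ of the system satisfies $a_id>r_i$, and singular otherwise. Let $\mathcal{B}^H_{\mathrm{nsg}}$ be the set of $i\in\mathcal{I}^H_{(0,0)}$ such that $\nabla H_i(x^\star)^Td\ge0$ is nonsingular in the linear system defining $\mathcal{L}(x^\star)$ above, i.e. some $d\in\mathcal{L}(x^\star)$ has $\nabla H_i(x^\star)^Td>0$. Let $\mathcal{B}_{\mathrm{nsg}}=\{(i,j)\in\mathcal{I}_{(0,0)}\mid i\in\mathcal{B}^H_{\mathrm{nsg}}\}$. Partial BVC-LICQ with $\mathcal{B}^H_{\mathrm{nsg}}$ holds at $x^\star$ if, for all $\mu^g\in\mathbb{R}^{n_g}$, $\mu^h\in\mathbb{R}^{n_h}$, $\mu^H\in\mathbb{R}^{n_H}$, $\mu^G\in\mathbb{R}^{n_G\cdot n_H}$ satisfying $$0=\sum_{k}\mu^g_k\nabla g_k(x^\star)+\sum_{l\in\mathcal{I}_h}\mu^h_l\nabla h_l(x^\star)+\sum_{(i,j)\in\mathcal{I}_{(+,0)}}\mu^G_{ij}\nabla G_{i,j}(x^\star)+\sum_{(i,j)\in\mathcal{I}_{(0,0)}}\mu^G_{ij}\nabla G_{i,j}(x^\star)+\sum_{i\in\mathcal{I}^H_{(0,-)}}\mu^H_i\nabla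 H_i(x^\star)+\sum_{i\in\mathcal{I}^H_{(0,0)}}\mu^H_i\nabla H_i(x^\star)+\sum_{i\in\mathcal{I}^H_{(0,+)}}\mu^H_i\nabla H_i(x^\star),$$ it follows that $\mu^G_{ij}=0$ for all $(i,j)\in\mathcal{B}_{\mathrm{nsg}}$. *)

(* Defs.v *)
From HB Require Import structures.
From mathcomp Require Export all_boot all_order all_algebra.
From mathcomp Require Export all_classical all_reals all_analysis.
Export Order.TTheory GRing.Theory Num.Theory numFieldNormedType.Exports.

Set Implicit Arguments.
Unset Strict Implicit.
Unset Printing Implicit Defensive.

Local Open Scope classical_set_scope.
Local Open Scope ring_scope.

Definition dot (R : realType) (n : nat) (u v : 'rV[R]_n) : R :=
  \sum_(a < n) u 0 a * v 0 a.

Definition grad (R : realType) (n : nat) (f : 'rV[R]_n -> R) (x : 'rV[R]_n) :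
  'rV[R]_n := \row_a 'D_(delta_mx 0 a) f x.

(* Class C^k through partial derivatives: those of order at most k exist
   everywhere and are continuous. *)
Fixpoint classC (R : realType) (n : nat) (W : normedModType R) (k : nat)
    (f : 'rV[R]_n -> W) : Prop :=
  continuous f /\
  if k is k'.+1 then
    forall a : 'I_n, (forall x, derivable f x (delta_mx 0 a)) /\
                     classC k' ('D_(delta_mx 0 a) f)
  else True.

Definition polar (R : realType) (n : nat) (M : set 'rV[R]_n) : set 'rV[R]_n :=
  [set d | forall x, M x -> dot d x <= 0].

Definition tangent_cone (R : realType) (n : nat) (X : set 'rV[R]_n)
    (xs : 'rV[R]_n) : set 'rV[R]_n :=
  [set d | exists (x : nat -> 'rV[R]_n) (t : nat -> R),
    [/\ forall k, X (x k), forall k, 0 < t k, t @ \oo --> (0 : R),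
        x @ \oo --> xs & (fun k => (t k)^-1 *: (x k - xs)) @ \oo --> d]].

(* minimize obj subject to cg = 0, ch >= 0, cH i >= 0, cG i j * cH i >= 0 *)
Record mpbvc (R : realType) (n ng nh nH nG : nat) := MPBVC {
  obj : 'rV[R]_n -> R;
  cg : 'rV[R]_n -> 'rV[R]_ng;
  ch : 'rV[R]_n -> 'rV[R]_nh;
  cH : 'I_nH -> 'rV[R]_n -> R;
  cG : 'I_nH -> 'I_nG -> 'rV[R]_n -> R
}.

Section MPBVC.
Context {R : realType} {n ng nh nH nG : nat} (P : mpbvc R n ng nh nH nG).

Definition C2_data : Prop :=
  [/\ classC 2 (obj P), classC 2 (cg P), classC 2 (ch P),
      forall i, classC 2 (cH P i) & forall i j, classC 2 (cG P i j)].

Definition feasible : set 'rV[R]_n :=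
  [set x | [/\ cg P x = 0, forall l, 0 <= ch P x 0 l, forall i, 0 <= cH P i x
             & forall i j, 0 <= cG P i j x * cH P i x]].

Variable xs : 'rV[R]_n.

(* I_ab: a and b are the signs at xs of H_i and of G_ij
   (p: positive, 0: zero, m: negative). *)
Definition I_p0 : {set 'I_nH * 'I_nG} :=
  [set ij | (0 < cH P ij.1 xs) && (cG P ij.1 ij.2 xs == 0)]%SET.
Definition I_0p : {set 'I_nH * 'I_nG} :=
  [set ij | (cH P ij.1 xs == 0) && (0 < cG P ij.1 ij.2 xs)]%SET.
Definition I_00 : {set 'I_nH * 'I_nG} :=
  [set ij | (cH P ij.1 xs == 0) && (cG P ij.1 ij.2 xs == 0)]%SET.
Definition I_0m : {set 'I_nH * 'I_nG} :=
  [set ij | (cH P ij.1 xs == 0) && (cG P ij.1 ij.2 xs < 0)]%SET.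

Definition projH (I : {set 'I_nH * 'I_nG}) : {set 'I_nH} :=
  [set i | [exists j, (i, j) \in I]]%SET.

Definition I_h : {set 'I_nh} := [set l | ch P xs 0 l == 0]%SET.

Definition dg (k : 'I_ng) : 'rV[R]_n := grad (fun x => cg P x 0 k) xs.
Definition dh (l : 'I_nh) : 'rV[R]_n := grad (fun x => ch P x 0 l) xs.
Definition dH (i : 'I_nH) : 'rV[R]_n := grad (cH P i) xs.
Definition dG (i : 'I_nH) (j : 'I_nG) : 'rV[R]_n := grad (cG P i j) xs.

Definition lin_cone : set 'rV[R]_n :=
  [set d | [/\ forall k, dot (dg k) d = 0,
               forall l, l \in I_h -> 0 <= dot (dh l) d,
               forall i, i \in projH I_0m -> dot (dH i) d = 0,
               forall i, i \in projH I_00 :|: projH I_0p -> 0 <= dot (dH i) d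
             & forall i j, (i, j) \in I_p0 -> 0 <= dot (dG i j) d]].

Definition lin_cone_super : set 'rV[R]_n :=
  [set d | [/\ forall k, dot (dg k) d = 0,
               forall l, l \in I_h -> 0 <= dot (dh l) d,
               forall i, i \in projH I_0m -> dot (dH i) d = 0,
               forall i, i \in projH I_0p -> 0 <= dot (dH i) d
             & forall i j, (i, j) \in I_p0 -> 0 <= dot (dG i j) d]].

Definition lin_cone_BVC : set 'rV[R]_n :=
  [set d | [/\ lin_cone_super d,
               forall i, i \in projH I_00 -> 0 <= dot (dH i) d
             & forall i j, (i, j) \in I_00 ->
                 0 <= dot (dH i) d * dot (dG i j) d]].

Definition GCQ : Prop := polar lin_cone = polar (tangent_cone feasible xs).

Definition BVC_GCQ : Prop :=
  polar lin_cone_BVC = polar (tangent_cone feasible xs).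

Definition BH_nsg : set 'I_nH :=
  [set i | i \in projH I_00 /\ exists2 d, lin_cone d & 0 < dot (dH i) d].

(* Only the entries of the multipliers at the indices occurring in the sum
   matter; the others are unconstrained. *)
Definition partial_BVC_LICQ (BH : set 'I_nH) : Prop :=
  forall (mug : 'rV[R]_ng) (muh : 'rV[R]_nh) (muH : 'rV[R]_nH)
         (muG : 'M[R]_(nH, nG)),
    0 = \sum_k mug 0 k *: dg k
      + \sum_(l in I_h) muh 0 l *: dh l
      + \sum_(ij in I_p0) muG ij.1 ij.2 *: dG ij.1 ij.2
      + \sum_(ij in I_00) muG ij.1 ij.2 *: dG ij.1 ij.2
      + \sum_(i in projH I_0m) muH 0 i *: dH i
      + \sum_(i in projH I_00) muH 0 i *: dH i
      + \sum_(i in projH I_0p) muH 0 i *: dH i ->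
    forall i j, (i, j) \in I_00 -> BH i -> muG i j = 0.

End MPBVC.

(* Main.v *)
(** Partial BVC-LICQ says that the gradients of the [G i j] with [(i, j)] in
    [B_nsg] are linearly independent modulo the span of all the other active
    gradients.  By the Fredholm alternative, given [d] in the linearized cone,
    some [w] is orthogonal to those other gradients and satisfies
    [dot (dG i j) w = - dot (dG i j) d] on [B_nsg].  Then [d + w] and [- w] both
    lie in the BVC-linearized cone, so that [d = (d + w) + (- w)] shows that the
    two linearized cones have the same polar. *)
Require Import Defs.

Set Implicit Arguments.
Unset Strict Implicit.

Local Open Scope classical_set_scope.
Local Open Scope ring_scope.

Lemma dotDr (R : realType) (n : nat) (u v w : 'rV[R]_n) :
  dot u (v + w) = dot u v + dot u w.
Proof. by rewrite /dot -big_split /=; apply: eq_bigr => a _; rewrite mxE mulrDr. Qed.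

Lemma dotNr (R : realType) (n : nat) (u v : 'rV[R]_n) : dot u (- v) = - dot u v.
Proof. by rewrite /dot -sumrN; apply: eq_bigr => a _; rewrite mxE mulrN. Qed.

Lemma dotZl (R : realType) (n : nat) (k : R) (u v : 'rV[R]_n) :
  dot (k *: u) v = k * dot u v.
Proof. by rewrite /dot mulr_sumr; apply: eq_bigr => a _; rewrite mxE mulrA. Qed.

(** A vector lies in the row space of [A^T] iff the cokernel of [A^T] kills it, and each column of
    that cokernel is a linear relation among the [a s]. *)
Lemma fredholm_alternative (R : realType) (n : nat) (S : finType)
    (a : S -> 'rV[R]_n) (c : S -> R) :
  (forall u : S -> R, \sum_s u s *: a s = 0 -> \sum_s u s * c s = 0) ->
  exists w, forall s, dot (a s) w = c s.
Proof.
move=> cP.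
pose A : 'M[R]_(#|S|, n) := \matrix_(k, j) a (enum_val k) 0 j.
pose b : 'rV[R]_#|S| := \row_k c (enum_val k).
have /submxP[w bE] : (b <= A^T)%MS.
  rewrite submxE; move: (cokermx _) (mulmx_coker A^T) => K AK0.
  apply/eqP/rowP => t; rewrite [RHS]mxE.
  (* Column [t] of the cokernel, reindexed by [S], is the relation to which [cP] applies. *)
  pose u s := K (enum_rank s) t.
  rewrite -[RHS](cP u); last first.
    apply/rowP => j; rewrite summxE [RHS]mxE.
    have AKjt : (A^T *m K) j t = 0 by rewrite AK0 mxE.
    rewrite -[RHS]AKjt [RHS]mxE [RHS](reindex _ (onW_bij _ (@enum_rank_bij S))).
    by apply: eq_bigr => s _; rewrite !mxE enum_rankK mulrC.
  rewrite mxE [LHS](reindex _ (onW_bij _ (@enum_rank_bij S))).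
  by apply: eq_bigr => s _; rewrite mxE enum_rankK mulrC.
exists w => s; have /rowP/(_ (enum_rank s)) := bE.
rewrite !mxE enum_rankK => ->; apply: eq_bigr => j _.
by rewrite !mxE enum_rankK mulrC.
Qed.

Section MPBVC.
Context {R : realType} {n ng nh nH nG : nat} (P : mpbvc R n ng nh nH nG).
Variable xs : 'rV[R]_n.

Lemma lin_cone_BVC_sub : lin_cone_BVC P xs `<=` lin_cone P xs.
Proof.
move=> d [[dg0 dh0 dm dp dG0] d00 _]; split=> // i.
by rewrite finset.in_setU => /orP[/d00|/dp].
Qed.

Lemma projH_I_00 i j : (i, j) \in I_00 P xs -> i \in projH (I_00 P xs).
Proof. by move=> ijP; rewrite inE; apply/existsP; exists j. Qed.

Lemma I_00_notin_I_p0 ij : ij \in I_00 P xs -> ij \notin I_p0 P xs.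
Proof. by rewrite !inE => /andP[/eqP-> _]; rewrite ltxx. Qed.

(* [projH I_0m], [projH I_00] and [projH I_0p] may overlap: the sum defining
   LICQ counts [dH i] with this multiplicity. *)
Definition multH (i : 'I_nH) : R :=
  (i \in projH (I_0m P xs))%:R + (i \in projH (I_00 P xs))%:R
  + (i \in projH (I_0p P xs))%:R.

Lemma multH_neq0 i :
  [|| i \in projH (I_0m P xs), i \in projH (I_00 P xs)
    | i \in projH (I_0p P xs)] -> multH i != 0.
Proof. by rewrite /multH -!natrD pnatr_eq0; do 3!case: (_ \in _). Qed.

(** The right-hand side is nonzero at most on the pairs of [I_00] with [BH i]. There LICQ makes
    every relation among the active gradients have zero coefficients, so the Fredholm condition
    holds. *)
Lemma partial_BVC_LICQ_surj (BH : set 'I_nH) (c : 'I_nH -> 'I_nG -> R) :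
  partial_BVC_LICQ P xs BH ->
  exists w,
    [/\ forall k, dot (dg P xs k) w = 0,
        forall l, l \in I_h P xs -> dot (dh P xs l) w = 0,
        forall i, [|| i \in projH (I_0m P xs), i \in projH (I_00 P xs)
                    | i \in projH (I_0p P xs)] -> dot (dH P xs i) w = 0,
        forall i j, (i, j) \in I_p0 P xs -> dot (dG P xs i j) w = 0
      & forall i j, (i, j) \in I_00 P xs -> BH i ->
          dot (dG P xs i j) w = c i j].
Proof.
move=> licq.
(* Inactive gradients get weight 0 instead of being dropped, so one plain sum type indexes the
   system; the other weights are the multiplicities in the LICQ sum. *)
pose a (s : 'I_ng + ('I_nh + ('I_nH + 'I_nH * 'I_nG))) : 'rV[R]_n :=
  match s with
  | inl k => dg P xs k
  | inr (inl l) => (l \in I_h P xs)%:R *: dh P xs l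
  | inr (inr (inl i)) => multH i *: dH P xs i
  | inr (inr (inr ij)) =>
      ((ij \in I_p0 P xs)%:R + (ij \in I_00 P xs)%:R) *: dG P xs ij.1 ij.2
  end.
pose e (s : 'I_ng + ('I_nh + ('I_nH + 'I_nH * 'I_nG))) : R :=
  if s is inr (inr (inr ij)) then
    if (ij \in I_00 P xs) && `[< BH ij.1 >] then c ij.1 ij.2 else 0
  else 0.
have sumM (V : lmodType R) (T : finType) (D : {set T}) (m : T -> R) (v : T -> V) :
    \sum_(t in D) m t *: v t = \sum_t m t *: ((t \in D)%:R *: v t).
  rewrite big_mkcond; apply: eq_bigr => t _.
  by case: (_ \in _); rewrite ?scale1r // scale0r scaler0.
have [u u0|w wP] := @fredholm_alternative R n _ a e.
  have uG i j : (i, j) \in I_00 P xs -> BH i -> u (inr (inr (inr (i, j)))) = 0.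
    move=> ij0 BHi.
    have := licq (\row_k u (inl k)) (\row_l u (inr (inl l)))
      (\row_i u (inr (inr (inl i)))) (\matrix_(i, j) u (inr (inr (inr (i, j))))).
    move=> /(_ _ i j ij0 BHi); rewrite mxE; apply.
    rewrite -[LHS]u0 !big_sumType /= !sumM -!addrA.
    congr (_ + (_ + _)).
    - by apply: eq_bigr => k _; rewrite mxE.
    - by apply: eq_bigr => l _; rewrite mxE.
    (* The two sums over pairs merge into one, and the three sums over [i] merge into the weight
       [multH i]. *)
    rewrite [LHS]addrC [RHS]addrA; congr (_ + _).
      rewrite -big_split; apply: eq_bigr => -[k l] _ /=.
      by rewrite !mxE -scalerDr -scalerDl.
    rewrite -!big_split; apply: eq_bigr => k _ /=.
    by rewrite mxE -!scalerDr -!scalerDl addrA.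
  apply: big1 => -[k|[l|[i|[i j]]]] _ /=; rewrite ?mulr0 //.
  by case: ifP => [/andP[ij0 /asboolP BHi]|_]; rewrite ?mulr0 // uG // mul0r.
exists w; split=> [k|l lh|i iP|i j ijp|i j ij0 BHi].
- exact: (wP (inl k)).
- by have := wP (inr (inl l)); rewrite /a /e lh scale1r.
- have := wP (inr (inr (inl i))); rewrite /a /e dotZl => /eqP.
  by rewrite mulf_eq0 (negPf (multH_neq0 iP)) => /eqP.
- have ij0 : (i, j) \notin I_00 P xs by apply/negP => /I_00_notin_I_p0; rewrite ijp.
  by have := wP (inr (inr (inr (i, j)))); rewrite /a /e ijp (negPf ij0) addr0 scale1r.
- have := wP (inr (inr (inr (i, j)))).
  by rewrite /a /e ij0 (negPf (I_00_notin_I_p0 ij0)) add0r scale1r asboolT.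
Qed.

(** Adding [w] leaves the values on [d] of all constraints of [lin_cone] unchanged, so only the
    product condition on [I_00] is at stake. *)
Lemma lin_cone_split d :
  partial_BVC_LICQ P xs (BH_nsg P xs) -> lin_cone P xs d ->
  exists w, lin_cone_BVC P xs (d + w) /\ lin_cone_BVC P xs (- w).
Proof.
move=> licq dL; have [dg0 dh0 dm d0p dGp0] := dL.
have [w [wg wh wH wGp wG]] :=
  partial_BVC_LICQ_surj (fun i j => - dot (dG P xs i j) d) licq.
have wm i : i \in projH (I_0m P xs) -> dot (dH P xs i) w = 0.
  by move=> im; apply: wH; rewrite im.
have w0 i : i \in projH (I_00 P xs) -> dot (dH P xs i) w = 0.
  by move=> i0; apply: wH; rewrite i0 orbT.
have wp i : i \in projH (I_0p P xs) -> dot (dH P xs i) w = 0.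
  by move=> ip; apply: wH; rewrite ip !orbT.
exists w; split; split.
- split=> [k|l lh|i im|i ip|i j ijp]; rewrite dotDr.
  + by rewrite dg0 wg addr0.
  + by rewrite wh // addr0 dh0.
  + by rewrite dm // wm // addr0.
  + by rewrite wp // addr0 d0p // finset.in_setU ip orbT.
  + by rewrite wGp // addr0 dGp0.
- by move=> i i0; rewrite dotDr w0 // addr0 d0p // finset.in_setU i0.
- move=> i j ij0; have i0 := projH_I_00 ij0.
  rewrite !dotDr w0 // addr0.
  have : 0 <= dot (dH P xs i) d by rewrite d0p // finset.in_setU i0.
  (* If the first factor is positive, [d] itself witnesses that [i] is nonsingular, and then [w]
     cancels the second factor. *)
  rewrite le_eqVlt => /predU1P[<-|dHd]; first by rewrite mul0r.
  by rewrite wG ?subrr ?mulr0 //; split=> //; exists d.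
- split=> [k|l lh|i im|i ip|i j ijp]; rewrite dotNr.
  + by rewrite wg oppr0.
  + by rewrite wh // oppr0.
  + by rewrite wm // oppr0.
  + by rewrite wp // oppr0.
  + by rewrite wGp // oppr0.
- by move=> i i0; rewrite dotNr w0 // oppr0.
- by move=> i j /projH_I_00 i0; rewrite dotNr w0 // oppr0 mul0r.
Qed.

End MPBVC.

Theorem theorem12 (R : realType) (n ng nh nH nG : nat)
  (P : mpbvc R n ng nh nH nG) (xs : 'rV[R]_n) :
  (1 <= nH)%N -> (1 <= nG)%N ->
  C2_data P ->
  feasible P xs ->
  BVC_GCQ P xs ->
  partial_BVC_LICQ P xs (BH_nsg P xs) ->
  GCQ P xs.
Proof.
(* BVC-GCQ eliminates the tangent cone: it remains to compare the polars of the two linearized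
   cones. *)
move=> _ _ _ _ gcq licq; rewrite /GCQ -gcq; apply/seteqP; split=> v vP d dL.
  exact/vP/lin_cone_BVC_sub.
have [w [dwL wL]] := lin_cone_split licq dL.
by rewrite -[d](addrK w) dotDr -(addr0 0) lerD ?vP.
Qed.
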